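(* Let $U$ be a left vector space over a (not necessarily commutative) field $K$ and $U'$ a left vector space over a (not necessarily commutative) field $K'$, with $1\le\dim U<\infty$ and $1\le\dim U'<\infty$. Let $R=\mathrm{End}_K(U)$ and $R'=\mathrm{End}_{K'}(U')$, let $\mathfrak M=(\mathcal G,\mathcal L)$ and $\mathfrak M'=(\mathcal G',\mathcal L')$ be the associated Grassmann spaces, with canonical bijections $\Psi:\mathbb P(R)\to\mathcal G$ and $\Psi':\mathbb P(R')\to\mathcal G'$. For a mapping $\varphi:\mathbb P(R)\to\mathbb P(R')$ the following statements are equivalent: (a) $\varphi$ is a $\triangle$-isomorphism. (b) $\varphi$ is a $\sim$-isomorphism. (c) $\Psi^{-1}\varphi\Psi':\mathcal G\to\mathcal G'$ (mappings composed from left to right) is a collineation $\mathfrak M\to\mathfrak M'$.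
   Context: Rings are associative with unit $1\ne0$. Fields need not be commutative. Mappings are written on the right as exponents, and products of mappings (including products in endomorphism rings) are read from left to right. Projective line: $\mathbb P(R)$ is the set of all submodules $R(a,b)$ of the left module $R^2$ such that $(a,b)$ is the first row of a matrix in $\mathrm{GL}_2(R)$. Points $p,q\in\mathbb P(R)$ are distant, $p\,\triangle\,q$, if $p=R(a,b)$, $q=R(c,d)$ for some matrix $\begin{pmatrix}a&b\\c&d\end{pmatrix}\in\mathrm{GL}_2(R)$. Put $\triangle(p)=\{q\in\mathbb P(R)\mid q\,\triangle\,p\}$. Points $p,q$ are parallel, $p\parallel q$, if $\triangle(p)\subseteq\triangle(q)$ (known to be an equivalence relation). Points $p,q$ are adjacent, $p\sim q$, if there is $r\in\mathbb P(R)$ with $r\nparallel p$, $r\nparallel q$ and $\triangle(r)\subseteq\triangle(p)\cup\triangle(q)$. A $\triangle$-isomorphism (resp. $\sim$-isomorphism) $\mathbb P(R)\to\mathbb P(R')$ is a bijection preserving $\triangle$ (resp. $\sim$) in both directions. Grassmann space: with $n=\dim U$, the Grassmann space $\mathfrak M=(\mathcal G,\mathcal L)$ associated to $\mathbb P(\mathrm{End}_K(U))$ has as point set $\mathcal G$ the set of $n$-dimensional subspaces of $U\times U$ and as line set $\mathcal L$ the set of all pencils $\{X\in\mathcal G\mid M\subset X\subset N\}$ with $M\subset N\le U\times U$, $\dim M=n-1$, $\dim N=n+1$. The mapping $\Psi:\mathbb P(R)\to\mathcal G$, $R(a,b)\mapsto\{(u^a,u^b)\mid u\in U\}$, is a (known)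 well-defined bijection. $\mathfrak M'$ and $\Psi'$ are defined analogously from $U'$. A collineation is a bijection between point sets such that it and its inverse map lines onto lines. *)

(* Defs.v *)
From HB Require Import structures.
From mathcomp Require Import all_boot all_algebra.
From mathcomp Require Import boolp classical_sets functions.

Set Implicit Arguments.
Unset Strict Implicit.
Unset Printing Implicit Defensive.

Import GRing.Theory VectorInternalTheory.
Local Open Scope classical_set_scope.
Local Open Scope ring_scope.

Definition is_skew_field (K : unitRingType) : Prop :=
  forall x : K, x != 0 -> x \is a GRing.unit.

Section ProjectiveLine.
Variable R : nzRingType.

Definition GL2 : set 'M[R]_2 :=
  [set A | exists B : 'M[R]_2, A *m B = 1%:M /\ B *m A = 1%:M].

(* R(a, b) for v = (a, b); scaling of rows is by left multiplication. *)
Definition cyc (v : 'rV[R]_2) : set 'rV[R]_2 :=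
  [set w | exists r : R, w = r *: v].

Record proj_line := ProjPoint {
  proj_set :> set 'rV[R]_2;
  proj_setP : exists2 A, GL2 A & proj_set = cyc (row 0 A) }.

Lemma proj_point_inj (p q : proj_line) :
  p = q :> set 'rV[R]_2 -> p = q.
Proof.
case: p q => [p hp] [q hq] /= epq; subst q.
by rewrite (Prop_irrelevance hp hq).
Qed.

Definition distant (p q : proj_line) : Prop :=
  exists A : 'M[R]_2,
    [/\ GL2 A, p = cyc (row 0 A) :> set _ & q = cyc (row 1 A) :> set _].

Definition distant_set (p : proj_line) : set proj_line :=
  [set q | distant q p].

Definition parallel (p q : proj_line) : Prop :=
  distant_set p `<=` distant_set q.

Definition adjacent (p q : proj_line) : Prop :=
  exists r : proj_line,
    [/\ ~ parallel r p, ~ parallel r q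
      & distant_set r `<=` distant_set p `|` distant_set q].

Lemma GL2_1 : GL2 1%:M.
Proof. by exists 1%:M; rewrite mulmx1. Qed.

Definition proj_base : proj_line :=
  ProjPoint (ex_intro2 _ _ 1%:M GL2_1 (erefl (cyc (row 0 1%:M)))).

End ProjectiveLine.

Arguments GL2 {R}.

Definition rel_isomorphism (T T' : Type) (r : T -> T -> Prop)
    (r' : T' -> T' -> Prop) (f : T -> T') : Prop :=
  bijective f /\ forall p q, r p q <-> r' (f p) (f q).

Definition distant_isomorphism (R R' : nzRingType) :=
  rel_isomorphism (@distant R) (@distant R').

Definition adjacent_isomorphism (R R' : nzRingType) :=
  rel_isomorphism (@adjacent R) (@adjacent R').

Section EndomorphismRing.
Variables (K : nzRingType) (U : vectType K).
Hypothesis U_gt0 : (0 < dim U)%N.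

(* Products are read from left to right: (f * g) u = g (f u). *)
Definition mul_end (f g : 'End(U)) : 'End(U) := (g \o f)%VF.

Fact mul_endA : associative mul_end.
Proof. by move=> f g h; rewrite /mul_end comp_lfunA. Qed.

Fact mul_end1l : left_id \1%VF mul_end.
Proof. by move=> f; rewrite /mul_end comp_lfun1r. Qed.

Fact mul_end1r : right_id \1%VF mul_end.
Proof. by move=> f; rewrite /mul_end comp_lfun1l. Qed.

Fact mul_endDl : left_distributive mul_end +%R.
Proof. by move=> f g h; rewrite /mul_end comp_lfunDr. Qed.

Fact mul_endDr : right_distributive mul_end +%R.
Proof. by move=> f g h; rewrite /mul_end comp_lfunDl. Qed.

Fact end1_neq0 : \1%VF != 0 :> 'End(U).
Proof.
apply/eqP=> /lfunP/(_ (r2v (const_mx 1))).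
rewrite !lfunE /= => /(canRL (@r2vK _ _)).
by move=> /rowP/(_ (Ordinal U_gt0))/eqP; rewrite linear0 !mxE oner_eq0.
Qed.

(* The library only packs this ring for a commutative ring of scalars. *)
Definition end_ring : nzRingType :=
  HB.pack 'End(U) (GRing.Zmodule_isNzRing.Build 'End(U)
    mul_endA mul_end1l mul_end1r mul_endDl mul_endDr end1_neq0).

End EndomorphismRing.

(* The library's subspaces and \dim require commutative scalars. *)
Section Subspaces.
Variables (K : nzRingType) (V : lmodType K).

Definition lin_indep d (b : 'I_d -> V) : Prop :=
  forall c : 'I_d -> K, \sum_i c i *: b i = 0 -> forall i, c i = 0.

Definition lin_span d (b : 'I_d -> V) : set V :=
  [set v | exists c : 'I_d -> K, v = \sum_i c i *: b i].

Definition subspace_of_dim (d : nat) (X : set V) : Prop :=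
  exists b : 'I_d -> V, lin_indep b /\ X = lin_span b.

End Subspaces.

Section Grassmann.
Variables (K : nzRingType) (U : vectType K).

Record grass := GrassPoint {
  grass_set :> set (U * U)%type;
  grass_setP : subspace_of_dim (dim U) grass_set }.

Lemma grass_inj (X Y : grass) : X = Y :> set (U * U)%type -> X = Y.
Proof.
case: X Y => [X hX] [Y hY] /= eXY; subst Y.
by rewrite (Prop_irrelevance hX hY).
Qed.

(* Inclusions are strict for reasons of dimension. *)
Definition grass_lines : set (set grass) :=
  [set l | exists M N : set (U * U)%type,
    [/\ subspace_of_dim (dim U).-1 M, subspace_of_dim (dim U).+1 N, M `<=` N
      & l = [set X : grass | M `<=` X /\ X `<=` N]]].

End Grassmann.

Definition collineation (T T' : Type) (L : set (set T)) (L' : set (set T'))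
    (f : T -> T') : Prop :=
  exists g : T' -> T,
    [/\ cancel f g, cancel g f,
        forall l, L l -> L' (f @` l) & forall l', L' l' -> L (g @` l')].

Section Psi.
Variables (K : nzRingType) (U : vectType K) (U_gt0 : (0 < dim U)%N).
Local Notation R := (end_ring U_gt0).

Lemma end_mulE (f g : R) (u : U) :
  ((f * g : R) : 'End(U)) u = (g : 'End(U)) ((f : 'End(U)) u).
Proof. by rewrite -comp_lfunE. Qed.

Definition pair_image (v : 'rV[R]_2) : set (U * U)%type :=
  [set w | exists u : U, w = ((v 0 0 : 'End(U)) u, (v 0 1 : 'End(U)) u)].

(* The union does not refer to a generator of p; by Psi_setE it is the image
   of any admissible generator. *)
Definition Psi_set (p : proj_line R) : set (U * U)%type :=
  \bigcup_(v in (p : set _)) pair_image v.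

Lemma Psi_setE (p : proj_line R) (v : 'rV[R]_2) :
  p = cyc v :> set _ -> Psi_set p = pair_image v.
Proof.
rewrite /Psi_set => ->; apply/seteqP; split=> [w [_ [r ->] [u ->]]|w vw].
  by exists ((r : 'End(U)) u); rewrite !mxE !end_mulE.
by exists v; [exists 1; rewrite scale1r | exact: vw].
Qed.

Lemma Psi_set_dim (p : proj_line R) : subspace_of_dim (dim U) (Psi_set p).
Proof.
have [A [B [AB _]] pA] := proj_setP p.
rewrite (Psi_setE pA).
set v := row 0 A.
have vB u : (B 0 0 : 'End(U)) ((v 0 0 : 'End(U)) u)
    + (B 1 0 : 'End(U)) ((v 0 1 : 'End(U)) u) = u.
  have := congr1 (fun M : 'M[R]_2 => (M 0 0 : 'End(U)) u) AB.
  rewrite !mxE !big_ord_recl big_ord0 addr0 /= add_lfunE.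
  have -> : lift ord0 ord0 = 1 :> 'I_2 by apply/val_inj.
  by rewrite !end_mulE id_lfunE.
pose e (i : 'I_(dim U)) : U := r2v (delta_mx 0 i).
have eE (c : 'I_(dim U) -> K) :
    v2r (\sum_i c i *: e i) = \row_i c i.
  rewrite [RHS]row_sum_delta linear_sum; apply: eq_bigr => i _.
  by rewrite linearZ /= r2vK mxE.
pose h u : U * U := ((v 0 0 : 'End(U)) u, (v 0 1 : 'End(U)) u).
have hE (c : 'I_(dim U) -> K) : \sum_i c i *: h (e i) = h (\sum_i c i *: e i).
  rewrite /h !linear_sum [LHS]surjective_pairing.
  rewrite (big_morph fst (id1 := 0) (op1 := +%R)) //.
  rewrite (big_morph snd (id1 := 0) (op1 := +%R)) //.
  by congr (_, _); apply: eq_bigr => i _; rewrite [RHS]linearZ.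
exists (fun i => h (e i)); split.
  move=> c; rewrite hE => -[h0 h1] i.
  have u0 : \sum_i c i *: e i = 0 by rewrite -[LHS]vB h0 h1 !linear0 addr0.
  by have /rowP/(_ i) := eE c; rewrite u0 linear0 !mxE.
apply/seteqP; split=> [_ [u ->]|_ [c ->]].
  exists (fun i => v2r u 0 i); rewrite hE.
  suff <- : u = \sum_i v2r u 0 i *: e i by [].
  apply: (@v2r_inj _ U); rewrite eE.
  by apply/rowP => i; rewrite mxE.
by rewrite hE; exists (\sum_i c i *: e i).
Qed.

Definition Psi (p : proj_line R) : grass U := GrassPoint (Psi_set_dim p).

(* Inverse of the bijection Psi; the default value proj_base is never used
   when the scalars form a skew field. *)
Definition Psi_inv : grass U -> proj_line R :=
  'pinv_(fun=> proj_base R) setT Psi.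

End Psi.

Arguments Psi {K U} U_gt0 p.
Arguments Psi_inv {K U} U_gt0 X.

(* Main.v *)
Require Import Defs.
From HB Require Import structures.
From mathcomp Require Import all_boot all_algebra.
From mathcomp Require Import boolp classical_sets functions.
From mathcomp Require Import zify.

(* Psi turns "distant" into "complementary subspaces of U x U" and "adjacent"
   into "meeting in dimension n - 1". For the second claim: if every complement
   of Z is a complement of X or of Y, then x in X \ Z and y in Y \ Z must be
   dependent modulo Z, since otherwise some complement of Z contains both;
   hence X + Z = Y + Z has dimension n + 1. Conversely, if x and y extend X & Y
   to X and Y, then Z = (X & Y) + <x + y> works.

   The implications then only use the adjacency graph. Its distance is
   n - dim (X & Y), so complementary means maximal distance, and the line
   through adjacent X and Y consists of the Z that are equal or adjacent to
   every W equal or adjacent to both X and Y. *)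

Set Implicit Arguments.
Unset Strict Implicit.
Unset Printing Implicit Defensive.

Import GRing.Theory VectorInternalTheory.
Local Open Scope classical_set_scope.
Local Open Scope ring_scope.

(** * Subspaces over a division ring *)

Identity Coercion set_pred : set >-> Funclass.

Section Submodules.
Variables (K : nzRingType) (V : lmodType K).

Record submod := Submod {
  submod_set :> set V;
  submodP : submod_set 0 /\
    forall a u v, submod_set u -> submod_set v -> submod_set (a *: u + v) }.

Lemma submod_inj (X Y : submod) : X = Y :> set V -> X = Y.
Proof.
case: X Y => [X hX] [Y hY] /= eXY; subst Y.
by rewrite (Prop_irrelevance hX hY).
Qed.

Lemma submod_eq (X Y : submod) : X `<=` Y -> Y `<=` X -> X = Y.
Proof. by move=> XY YX; apply/submod_inj/seteqP. Qed.

Lemma submod0 (X : submod) : X 0.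
Proof. exact: (submodP X).1. Qed.

Lemma submodZD (X : submod) a u v : X u -> X v -> X (a *: u + v).
Proof. exact: (submodP X).2. Qed.

Lemma submodD (X : submod) u v : X u -> X v -> X (u + v).
Proof. by rewrite -{2}[u]scale1r; apply: submodZD. Qed.

Lemma submodZ (X : submod) a u : X u -> X (a *: u).
Proof. by move=> Xu; rewrite -[_ *: _]addr0; apply: submodZD (submod0 X). Qed.

Lemma submodN (X : submod) u : X u -> X (- u).
Proof. by rewrite -scaleN1r; apply: submodZ. Qed.

Lemma submodB (X : submod) u v : X u -> X v -> X (u - v).
Proof. by move=> Xu /submodN; apply: submodD. Qed.

Lemma addsub_subproof (X Y : submod) :
  let S := [set w | exists u v, [/\ X u, Y v & w = u + v]] in
  S 0 /\ forall a u v, S u -> S v -> S (a *: u + v).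
Proof.
split=> [|a _ _ [x [y [Xx Yy ->]]] [x' [y' [Xx' Yy' ->]]]].
  by exists 0, 0; split; rewrite ?addr0 //; apply: submod0.
exists (a *: x + x'), (a *: y + y').
by rewrite scalerDr addrACA; split=> //; apply: submodZD.
Qed.
Definition addsub X Y := Submod (addsub_subproof X Y).

Lemma capsub_subproof (X Y : submod) :
  let S := X `&` Y in S 0 /\ forall a u v, S u -> S v -> S (a *: u + v).
Proof.
split=> [|a u v [Xu Yu] [Xv Yv]]; first by split; apply: submod0.
by split; apply: submodZD.
Qed.
Definition capsub X Y := Submod (capsub_subproof X Y).

Lemma linesub_subproof (x : V) :
  let S := [set w | exists k : K, w = k *: x] in
  S 0 /\ forall a u v, S u -> S v -> S (a *: u + v).
Proof.
split=> [|a _ _ [k ->] [l ->]]; first by exists 0; rewrite scale0r.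
by exists (a * k + l); rewrite scalerDl scalerA.
Qed.
Definition linesub x := Submod (linesub_subproof x).

Definition topsub : submod := @Submod setT (conj I (fun _ _ _ _ _ => I)).

Lemma spansub_subproof d (b : 'I_d -> V) :
  let S := lin_span b in S 0 /\ forall a u v, S u -> S v -> S (a *: u + v).
Proof.
split=> [|a _ _ [c ->] [c' ->]].
  by exists (fun=> 0); rewrite big1 // => i _; rewrite scale0r.
exists (fun i => a * c i + c' i); rewrite scaler_sumr -big_split.
by apply: eq_bigr => i _; rewrite scalerDl scalerA.
Qed.
Definition spansub d b := Submod (@spansub_subproof d b).

Lemma linesub_id x : linesub x x.
Proof. by exists 1; rewrite scale1r. Qed.

Lemma linesub_sub (X : submod) x : X x -> linesub x `<=` X.
Proof. by move=> Xx _ [k ->]; apply: submodZ. Qed.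

Lemma addsub_l (X Y : submod) : X `<=` addsub X Y.
Proof. by move=> x Xx; exists x, 0; rewrite addr0; split=> //; apply: submod0. Qed.

Lemma addsub_r (X Y : submod) : Y `<=` addsub X Y.
Proof. by move=> x Xx; exists 0, x; rewrite add0r; split=> //; apply: submod0. Qed.

Lemma addsub_lub (X Y Z : submod) : X `<=` Z -> Y `<=` Z -> addsub X Y `<=` Z.
Proof. by move=> XZ YZ _ [x [y [/XZ Zx /YZ Zy ->]]]; apply: submodD. Qed.

Lemma addsubC (X Y : submod) : addsub X Y = addsub Y X.
Proof.
by apply: submod_eq; apply: addsub_lub; [apply: addsub_r | apply: addsub_l
  | apply: addsub_r | apply: addsub_l].
Qed.

Lemma lin_span_id d (b : 'I_d -> V) i : lin_span b (b i).
Proof.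
exists (fun j => (j == i)%:R).
rewrite (bigD1 i) //= eqxx scale1r big1 ?addr0 // => j /negbTE->.
by rewrite scale0r.
Qed.

Lemma subspace_submod d (X : set V) :
  subspace_of_dim d X -> exists Y : submod, X = Y.
Proof. by case=> b [_ ->]; exists (spansub b). Qed.

Definition disjointsub (X Y : submod) := forall x, X x -> Y x -> x = 0.

Lemma subspace_of_dim_add d e (X Y : submod) : disjointsub X Y ->
  subspace_of_dim d X -> subspace_of_dim e Y ->
  subspace_of_dim (d + e) (addsub X Y).
Proof.
move=> XY0 [b [fb Xb]] [c [fc Yc]].
pose f (i : 'I_(d + e)) := match fintype.split i with inl j => b j | inr k => c k end.
have fl j : f (lshift e j) = b j.
  by rewrite /f -[lshift e j]/(unsplit (inl j)) unsplitK.
have fr j : f (rshift d j) = c j.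
  by rewrite /f -[rshift d j]/(unsplit (inr j)) unsplitK.
have fE (a : 'I_(d + e) -> K) : \sum_i a i *: f i =
    \sum_j a (lshift e j) *: b j + \sum_j a (rshift d j) *: c j.
  rewrite big_split_ord; congr (_ + _); apply: eq_bigr => i _; by rewrite ?fl ?fr.
exists f; split=> [a|].
  rewrite fE => s0.
  have Xs : X (\sum_j a (lshift e j) *: b j) by rewrite Xb; eexists.
  have Ys : Y (\sum_j a (rshift d j) *: c j) by rewrite Yc; eexists.
  have Y0 := XY0 _ Xs; move: s0 => /(canRL (addrK _)); rewrite add0r => s0.
  have {}Y0 := Y0 (eq_ind_r Y (submodN Ys) s0).
  move: s0; rewrite Y0 => /eqP; rewrite eq_sym oppr_eq0 => /eqP X0 i.
  rewrite -[i]splitK; case: (fintype.split i) => j /=; first exact: fb Y0 j.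
  exact: fc X0 j.
apply/seteqP; split=> [_ [x [y [Xx Yy ->]]]|_ [a ->]].
  move: Xx Yy; rewrite Xb Yc => -[p ->] [q ->].
  exists (fun i => match fintype.split i with inl j => p j | inr k => q k end).
  rewrite fE; congr (_ + _); apply: eq_bigr => i _.
    by rewrite -[lshift e i]/(unsplit (inl i)) unsplitK.
  by rewrite -[rshift d i]/(unsplit (inr i)) unsplitK.
rewrite fE; do 2 eexists; split; last by [].
  by rewrite Xb; eexists.
by rewrite Yc; eexists.
Qed.

Lemma subspace_of_dim0 (X : submod) : X `<=` [set 0] -> subspace_of_dim 0 X.
Proof.
move=> X0; exists (fun=> 0); split=> [c _ []//|].
apply/seteqP; split=> [x /X0 ->|_ [c ->]]; first by exists (fun=> 0); rewrite big_ord0.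
by rewrite big_ord0; apply: submod0.
Qed.

End Submodules.

Definition division_ring (K : nzRingType) : Prop :=
  forall x : K, x != 0 -> exists y, y * x = 1.

Section Dimension.
Variables (K : nzRingType) (hK : division_ring K).

Lemma row_dependence m d (A : 'I_d -> 'I_m -> K) : (m < d)%N ->
  exists2 c : 'I_d -> K, exists i, c i != 0 & forall k, \sum_i c i * A i k = 0.
Proof.
elim: m d A => [|m IHm] [//|d] A.
  by exists (fun=> 1) => [|[]//]; exists ord0; apply: oner_neq0.
rewrite ltnS => md.
have [[i0 Ai0]|A0] := pselect (exists i, A i ord0 != 0); last first.
  have [c c0 cA] := IHm _ (fun i k => A i (lift ord0 k)) (ltnW md).
  exists c => // k; case: (unliftP ord0 k) => [j|] -> //.
  rewrite big1 // => i _; have [->|Ai] := eqVneq (A i ord0) 0; rewrite ?mulr0 //.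
  by case: A0; exists i.
have [a aA] := hK Ai0.
pose q j := A (lift i0 j) ord0 * a.
have qL (j : 'I_d) : unlift i0 (lift i0 j) = Some j := liftK i0 j.
have [c [i ci] cA] := IHm d
  (fun j k => A (lift i0 j) (lift ord0 k) - q j * A i0 (lift ord0 k)) md.
pose c' i := if unlift i0 i is Some j then c j else - \sum_j c j * q j.
have c'L j : c' (lift i0 j) = c j by rewrite /c' qL.
exists c' => [|k]; first by exists (lift i0 i); rewrite c'L.
rewrite (bigD1_ord i0) //= {1}/c' unlift_none.
under eq_bigr do rewrite c'L.
rewrite mulNr mulr_suml addrC -sumrB.
case: (unliftP ord0 k) => [j|] ->.
  by rewrite -[RHS](cA j); apply: eq_bigr => l _; rewrite mulrBr (mulrA (c l) (q l)).
by rewrite big1 // => l _; rewrite /q -!mulrA aA mulr1 subrr.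
Qed.

Variable V : lmodType K.
Implicit Types X Y Z : submod V.

Lemma lin_indep_leq d m (b : 'I_d -> V) (e : 'I_m -> V) :
  lin_indep b -> (forall i, lin_span e (b i)) -> (d <= m)%N.
Proof.
move=> fb /choice[A bA]; rewrite leqNgt; apply/negP => /(row_dependence A).
case=> c [i /eqP ci] cA; apply/ci/fb.
under eq_bigr => j _ do rewrite bA scaler_sumr.
rewrite exchange_big big1 //= => k _.
under eq_bigr => j _ do rewrite scalerA.
by rewrite -scaler_suml cA scale0r.
Qed.

Lemma subspace_of_dim_leq d e (X Y : set V) :
  subspace_of_dim d X -> subspace_of_dim e Y -> X `<=` Y -> (d <= e)%N.
Proof.
move=> [b [fb ->]] [c [_ ->]] XY; apply: (lin_indep_leq fb) => i.
exact/XY/lin_span_id.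
Qed.

Lemma subspace_of_dim_line (x : V) : x != 0 -> subspace_of_dim 1 (linesub x).
Proof.
move=> x0; exists (fun=> x); split=> [c|].
  rewrite big_ord1 => cx i; rewrite ord1; apply/eqP/negP => /negP c0.
  have [a ac] := hK c0.
  by case/eqP: x0; rewrite -[x]scale1r -ac -scalerA cx scaler0.
apply/seteqP; split=> [_ [k ->]|_ [c ->]].
  by exists (fun=> k); rewrite big_ord1.
by exists (c ord0); rewrite big_ord1.
Qed.

Lemma linesub_mem (x y : V) : linesub x y -> y != 0 -> linesub y x.
Proof.
move=> [k ->] kx; have k0 : k != 0 by apply: contraNneq kx => ->; rewrite scale0r.
by have [l lk] := hK k0; exists l; rewrite scalerA lk scale1r.
Qed.

Lemma disjoint_line X x : ~ X x -> disjointsub X (linesub x).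
Proof.
move=> Xx y Xy xy; apply/eqP/negP => /negP y0; apply: Xx.
exact: (linesub_sub Xy (linesub_mem xy y0)).
Qed.

Variable m : nat.
Hypothesis dimV : subspace_of_dim m [set: V].

Lemma submod_has_dim X : exists d, subspace_of_dim d X.
Proof.
have: exists2 Y : submod V, Y `<=` X & subspace_of_dim 0 Y.
  exists (linesub 0) => [|]; first by apply: linesub_sub; apply: submod0.
  by apply: subspace_of_dim0 => _ [k ->]; rewrite /= scaler0.
have: (m - 0 <= m)%N by lia.
move: {2}m 0%N => k; elim: k => [|k IHk] d dk [Y YX dY];
  have dm := subspace_of_dim_leq dY dimV (fun _ _ => I);
  have [XY|/nonsubset[x [Xx Yx]]] := pselect (X `<=` Y).
- by exists d; rewrite (submod_eq XY YX).
- have x0 : x != 0 by apply/eqP => x0; apply: Yx; rewrite x0; apply: submod0.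
  have dYx := subspace_of_dim_add (disjoint_line Yx) dY (subspace_of_dim_line x0).
  by have := subspace_of_dim_leq dYx dimV (fun _ _ => I); lia.
- by exists d; rewrite (submod_eq XY YX).
have x0 : x != 0 by apply/eqP => x0; apply: Yx; rewrite x0; apply: submod0.
apply: (IHk (d + 1)%N); first by lia.
exists (addsub Y (linesub x)).
  by apply: addsub_lub => //; apply: linesub_sub.
exact: subspace_of_dim_add (disjoint_line Yx) dY (subspace_of_dim_line x0).
Qed.

(* Junk value 0 on sets that are not finite-dimensional subspaces. *)
Definition sdim (X : set V) : nat := xget 0%N [set d | subspace_of_dim d X].

Lemma sdimP X : subspace_of_dim (sdim X) X.
Proof.
have [d dX] := submod_has_dim X; rewrite /sdim.
by case: xgetP => [e _ /=|/(_ d)].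
Qed.

Lemma sdim_eq d (X : set V) : subspace_of_dim d X -> sdim X = d.
Proof.
move=> dX; rewrite /sdim; case: xgetP => [e _ /= eX|/(_ d)//].
by apply/eqP; rewrite eqn_leq !(subspace_of_dim_leq eX dX, subspace_of_dim_leq dX eX).
Qed.

Lemma sdim_top : sdim (topsub V) = m.
Proof. exact: sdim_eq. Qed.

Lemma sdim_leq X Y : X `<=` Y -> (sdim X <= sdim Y)%N.
Proof. by apply: subspace_of_dim_leq; apply: sdimP. Qed.

Lemma sdim_line x : x != 0 -> sdim (linesub x) = 1%N.
Proof. by move/subspace_of_dim_line/sdim_eq. Qed.

Lemma sdim_disjoint X Y : disjointsub X Y -> sdim (addsub X Y) = (sdim X + sdim Y)%N.
Proof. by move=> XY; apply/sdim_eq/subspace_of_dim_add => //; apply: sdimP. Qed.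

Lemma sdim_add_line X x : ~ X x -> sdim (addsub X (linesub x)) = (sdim X).+1.
Proof.
move=> Xx; rewrite sdim_disjoint ?sdim_line ?addn1 //; last exact: disjoint_line.
by apply/eqP => x0; apply: Xx; rewrite x0; apply: submod0.
Qed.

Lemma submod_eqP X Y : X `<=` Y -> (sdim Y <= sdim X)%N -> X = Y.
Proof.
move=> XY dYX; apply: submod_eq => // y Yy; apply: contrapT => Xy.
have /sdim_leq : addsub X (linesub y) `<=` Y.
  by apply: addsub_lub => //; apply: linesub_sub.
by rewrite sdim_add_line //; lia.
Qed.

Lemma sdim0P X : reflect (forall x, X x -> x = 0) (sdim X == 0%N).
Proof.
apply: (iffP eqP) => [dX x Xx|X0]; last exact/sdim_eq/subspace_of_dim0.
apply/eqP/negP => /negP x0; have := sdim_leq (linesub_sub Xx).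
by rewrite sdim_line // dX.
Qed.

Lemma sdim_ltP X Y : X `<=` Y -> (sdim X < sdim Y)%N -> exists2 y, Y y & ~ X y.
Proof.
move=> XY dXY; apply: contrapT => h.
have /sdim_leq : Y `<=` X; last by lia.
by move=> y Yy; apply: contrapT => Xy; apply: h; exists y.
Qed.

Lemma disjoint_add_line X Z x : disjointsub X Z -> ~ addsub X Z x ->
  disjointsub X (addsub Z (linesub x)).
Proof.
move=> XZ XZx w Xw [z [y [Zz xy wE]]].
have y0 : y = 0.
  apply: (disjoint_line XZx) xy; exists w, (- z); split=> //; first exact: submodN.
  by rewrite wE addrC addKr.
by apply: XZ => //; rewrite wE y0 addr0.
Qed.

Lemma complement X Z : disjointsub X Z ->
  exists Y, [/\ Z `<=` Y, disjointsub X Y & addsub X Y = topsub V].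
Proof.
have: (m - sdim Z <= m)%N by lia.
move: {2}m => k; elim: k Z => [|k IHk] Z dk XZ;
    have [tXZ|/existsNP[x XZx]] := pselect (forall x, addsub X Z x);
    try by exists Z; split=> //; apply: submod_eq.
  have Zt : Z = topsub V by apply: submod_eqP => //; rewrite sdim_top; lia.
  by case: XZx; apply: addsub_r; rewrite Zt.
have [||Y [ZY XY tXY]] := IHk (addsub Z (linesub x)).
- by rewrite sdim_add_line; [lia|move=> /addsub_r].
- exact: disjoint_add_line.
by exists Y; split=> // z Zz; apply/ZY/addsub_l.
Qed.

Lemma sdim_add_cap X Y :
  (sdim (addsub X Y) + sdim (capsub X Y) = sdim X + sdim Y)%N.
Proof.
have [C [_ IC tC]] : exists C : submod V, [/\ linesub 0 `<=` C, disjointsub (capsub X Y) C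
    & addsub (capsub X Y) C = topsub V].
  by apply: complement => x _ [k ->]; rewrite scaler0.
have Ysplit y : Y y -> exists x z, [/\ capsub X Y x, capsub C Y z & y = x + z].
  move=> Yy; have [x [z [[Xx Yx] Cz yE]]] : addsub (capsub X Y) C y by rewrite tC.
  exists x, z; split=> //; split=> //.
  by rewrite -[z](addKr x) -yE addrC; apply: submodB.
have -> : addsub X Y = addsub X (capsub C Y).
  apply: submod_eq; apply: addsub_lub; try exact: addsub_l.
    move=> y /Ysplit[x [z [[Xx _] CYz ->]]]; by exists x, z.
  by move=> y [_ Yy]; apply: addsub_r.
rewrite sdim_disjoint; last by move=> x Xx [Cx Yx]; apply: IC.
have YE : addsub (capsub X Y) (capsub C Y) = Y.
  by apply: submod_eq; [apply: addsub_lub => y [] | ].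
rewrite -[in RHS]YE (@sdim_disjoint (capsub X Y)); first by lia.
by move=> x XYx [Cx _]; apply: IC.
Qed.

Lemma intermediate_submod X Y d : X `<=` Y -> (sdim X <= d <= sdim Y)%N ->
  exists Z, [/\ X `<=` Z, Z `<=` Y & sdim Z = d].
Proof.
move=> XY; have [k dk] : exists k, (d - sdim X = k)%N by exists (d - sdim X)%N.
elim: k X XY dk => [|k IHk] X XY dk dXY; first by exists X; split=> //; lia.
have [|y Yy Xy] := sdim_ltP XY; first by lia.
have dXy := sdim_add_line Xy.
have [|||Z [XZ ZY dZ]] := IHk (addsub X (linesub y)); try lia.
  by apply: addsub_lub => //; apply: linesub_sub.
by exists Z; split=> // x Xx; apply/XZ/addsub_l.
Qed.

End Dimension.

(** * Subspaces of [U * U] and matrices over [End(U)] *)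

Lemma inj_surj_bij (T T' : Type) (f : T -> T') :
  injective f -> (forall y, exists x, f x = y) -> bijective f.
Proof. by move=> fI /choice[g gK]; exists g => // x; apply: fI. Qed.

Section PsiTheory.
Variables (K : nzRingType) (U : vectType K) (U_gt0 : (0 < dim U)%N).
Local Notation R := (end_ring U_gt0).
(* Writing [U * U] here would leave [reverse_coercion] in the types, which blocks
   rewriting. *)
Local Notation V := (@Datatypes_prod__canonical__GRing_Lmodule K U U).

(* Matrices act on row vectors, from the right: [ev A (x, y) = (x, y) A]. *)
Definition ev (A : 'M[R]_2) (w : V) : V :=
  ((A 0 0 : 'End(U)) w.1 + (A 1 0 : 'End(U)) w.2,
   (A 0 1 : 'End(U)) w.1 + (A 1 1 : 'End(U)) w.2).

Lemma ord2_ind (P : 'I_2 -> Prop) : P 0 -> P 1 -> forall i, P i.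
Proof.
move=> P0 P1 [[|[|//]] i]; first by have -> : Ordinal i = 0 by apply/val_inj.
by have -> : Ordinal i = 1 by apply/val_inj.
Qed.

Lemma mulmx2E (A B : 'M[R]_2) i j (u : U) :
  ((A *m B) i j : 'End(U)) u = (B 0 j : 'End(U)) ((A i 0 : 'End(U)) u) +
                               (B 1 j : 'End(U)) ((A i 1 : 'End(U)) u).
Proof.
rewrite mxE !big_ord_recl big_ord0 addr0 /= add_lfunE !end_mulE.
by have -> : lift ord0 ord0 = 1 :> 'I_2 by apply/val_inj.
Qed.

Lemma ev_mul A B w : ev (A *m B) w = ev B (ev A w).
Proof. by rewrite /ev !mulmx2E /= !linearD /=; congr (_, _); rewrite addrACA. Qed.

Lemma ev1 w : ev 1%:M w = w.
Proof.
case: w => x y; rewrite /ev !mxE /= !id_lfunE !zero_lfunE.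
by rewrite addr0 add0r.
Qed.

Lemma evZD A a v w : ev A (a *: v + w) = a *: ev A v + ev A w.
Proof.
by rewrite /ev /= !linearD !linearZ /=; congr (_, _); rewrite /= scalerDr addrACA.
Qed.

Lemma ev_inj A B : ev A =1 ev B -> A = B.
Proof.
move=> AB; apply/matrixP; apply: ord2_ind; apply: ord2_ind; apply/lfunP => u;
  [have := AB (u, 0) | have := AB (u, 0) | have := AB (0, u) | have := AB (0, u)];
  by rewrite /ev /= !linear0 ?addr0 ?add0r => -[].
Qed.

Lemma linfun_ex (f : U -> U) :
  (forall a u v, f (a *: u + v) = a *: f u + f v) ->
  exists h : 'End(U), forall u, h u = f u.
Proof.
move=> fL; pose F : {linear U -> U} :=
  HB.pack f (GRing.isLinear.Build K U U *:%R f fL).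
by exists (linfun F) => u; rewrite lfunE.
Qed.

Lemma ev_ex (f : V -> V) :
  (forall a v w, f (a *: v + w) = a *: f v + f w) -> exists A, ev A =1 f.
Proof.
move=> fL.
have fD v w : f (v + w) = f v + f w by rewrite -{1}[v]scale1r fL scale1r.
have l1 a (u v : U) : (a *: u + v, 0) = a *: (u, 0) + (v, 0) :> V.
  by congr (_, _); rewrite /= scaler0 addr0.
have l2 a (u v : U) : (0, a *: u + v) = a *: (0, u) + (0, v) :> V.
  by congr (_, _); rewrite /= scaler0 addr0.
have [|h00 E00] := @linfun_ex (fun u => (f (u, 0)).1); first by move=> *; rewrite l1 fL.
have [|h01 E01] := @linfun_ex (fun u => (f (u, 0)).2); first by move=> *; rewrite l1 fL.
have [|h10 E10] := @linfun_ex (fun u => (f (0, u)).1); first by move=> *; rewrite l2 fL.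
have [|h11 E11] := @linfun_ex (fun u => (f (0, u)).2); first by move=> *; rewrite l2 fL.
exists (\matrix_(i, j) if i == 0 then if j == 0 then h00 else h01
                       else if j == 0 then h10 else h11) => -[x y].
rewrite /ev !mxE /= E00 E01 E10 E11 -[LHS]/((_, _) + (_, _)) -!surjective_pairing.
by rewrite -fD; congr f; congr (_, _); rewrite /= ?addr0 ?add0r.
Qed.

Lemma GL2P A : GL2 A <-> bijective (ev A).
Proof.
split=> [[B [AB BA]]|[g Ag gA]].
  by exists (ev B) => w; rewrite -ev_mul ?AB ?BA ev1.
have [a v w|B gB] := @ev_ex g.
  by apply: (can_inj Ag); rewrite gA evZD !gA.
by exists B; split; apply: ev_inj => w; rewrite ev_mul ev1 gB ?gA ?Ag.
Qed.

Lemma GL2_xrow (A : 'M[R]_2) : GL2 A -> GL2 (xrow 0 1 A).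
Proof.
case=> B [AB BA]; exists (B *m tperm_mx 0 1).
have t2 : tperm_mx 0 1 *m tperm_mx 0 1 = 1%:M :> 'M[R]_2.
  by rewrite /tperm_mx -perm_mxM perm.tperm2 perm_mx1.
rewrite xrowE; split; first by rewrite mulmxA -(mulmxA _ A) AB mulmx1 t2.
by rewrite mulmxA -(mulmxA B) t2 mulmx1 BA.
Qed.

Lemma row_xrow2 (A : 'M[R]_2) :
  row 0 (xrow 0 1 A) = row 1 A /\ row 1 (xrow 0 1 A) = row 0 A.
Proof. by split; apply/rowP => j; rewrite !mxE ?perm.tpermL ?perm.tpermR. Qed.

Lemma pair_image_row (A : 'M[R]_2) i w : pair_image (row i A) w <->
  exists u, w = ev A (if i == 0 then (u, 0) else (0, u)).
Proof.
by split=> -[u ->]; exists u; move: i; apply: ord2_ind;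
  rewrite !mxE /ev /= !linear0 ?addr0 ?add0r.
Qed.

Lemma Psi_sub (p q : proj_line R) : Psi_set p `<=` Psi_set q -> p `<=` q.
Proof.
have [A gA pA] := proj_setP p; have [B gB qB] := proj_setP q.
rewrite (Psi_setE pA) (Psi_setE qB) pA qB => AB _ [s ->].
case: gB => C [BC CB].
pose D := A *m C.
suff rE : row 0 A = D 0 0 *: row 0 B by exists (s * D 0 0); rewrite {1}rE scalerA.
have D01 : D 0 1 = 0.
  apply/lfunP => u; rewrite zero_lfunE.
  have /AB/pair_image_row[u' /= uE] : pair_image (row 0 A) (ev A (u, 0)).
    by apply/pair_image_row; exists u.
  have := congr1 (ev C) uE; rewrite -!ev_mul BC ev1 -/D => /(congr1 snd).
  by rewrite /ev /= linear0 addr0.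
have AE : A = D *m B by rewrite -mulmxA CB mulmx1.
clearbody D; rewrite AE; apply/rowP => j; rewrite !mxE !big_ord_recl big_ord0 addr0 /=.
have -> : lift ord0 ord0 = 1 :> 'I_2 by apply/val_inj.
by rewrite D01 mul0r addr0.
Qed.

Lemma Psi_inj : injective (Psi U_gt0).
Proof.
move=> p q /(congr1 (@grass_set _ _)) /= pq.
by apply/proj_point_inj/seteqP; split; apply: Psi_sub; rewrite pq.
Qed.


Lemma pair_image_subproof (v : 'rV[R]_2) :
  pair_image v 0 /\
    forall a x y, pair_image v x -> pair_image v y -> pair_image v (a *: x + y).
Proof.
split=> [|a _ _ [x ->] [y ->]]; first by exists 0; rewrite !linear0.
by exists (a *: x + y); rewrite !linearD !linearZ.
Qed.
Definition pair_sub v : submod V := Submod (pair_image_subproof v).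

Lemma GL2_pair_sub A : GL2 A ->
  disjointsub (pair_sub (row 0 A)) (pair_sub (row 1 A)) /\
  addsub (pair_sub (row 0 A)) (pair_sub (row 1 A)) = topsub V.
Proof.
move=> /GL2P[g Ag gA]; split.
  move=> w /pair_image_row[x ->] /pair_image_row[y] /(can_inj Ag)[-> _].
  by rewrite /ev /= !linear0 addr0.
apply: submod_eq => // w _; exists (ev A ((g w).1, 0)), (ev A (0, (g w).2)).
split; try by apply/pair_image_row; eexists.
rewrite -[RHS]/((_, _) + (_, _)) /ev /= !linear0 !addr0 !add0r.
by rewrite -[LHS]gA.
Qed.

Lemma pair_sub_dim A i : GL2 A -> subspace_of_dim (dim U) (pair_sub (row i A)).
Proof.
move=> gA; move: i; apply: ord2_ind.
  pose p := ProjPoint (ex_intro2 _ _ A gA (erefl _)).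
  by have := Psi_set_dim p; rewrite (@Psi_setE _ _ _ p (row 0 A)).
pose p := ProjPoint (ex_intro2 _ _ (xrow 0 1 A) (GL2_xrow gA) (erefl _)).
have := Psi_set_dim p; rewrite (@Psi_setE _ _ _ p (row 1 A)) //.
by rewrite /p /= (row_xrow2 A).1.
Qed.

Lemma prod_dim : subspace_of_dim (dim U + dim U) [set: V].
Proof.
have [d t] := GL2_pair_sub (GL2_1 R).
have := subspace_of_dim_add d (pair_sub_dim 0 (GL2_1 R)) (pair_sub_dim 1 (GL2_1 R)).
by rewrite t.
Qed.

Lemma submod_param (X : set V) : subspace_of_dim (dim U) X ->
  exists h : U -> V, [/\ forall a u v, h (a *: u + v) = a *: h u + h v,
    forall u, h u = 0 -> u = 0 & X = range h].
Proof.
case=> b [fb ->].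
exists (fun u => \sum_i v2r u 0 i *: b i); split=> [a u v|u /fb u0|].
- rewrite scaler_sumr -big_split; apply: eq_bigr => i _.
  by rewrite linearD linearZ !mxE scalerDl scalerA.
- by apply: v2r_inj; rewrite linear0; apply/rowP => i; rewrite u0 mxE.
apply/seteqP; split=> [_ [c ->]|_ [u _ <-]]; last by eexists.
exists (r2v (\row_i c i)) => //; rewrite r2vK.
by apply: eq_bigr => i _; rewrite mxE.
Qed.

Lemma complement_GL2 (X Y : submod V) :
  subspace_of_dim (dim U) X -> subspace_of_dim (dim U) Y ->
  disjointsub X Y -> addsub X Y = topsub V ->
  exists A, [/\ GL2 A, X = pair_sub (row 0 A) & Y = pair_sub (row 1 A)].
Proof.
move=> /submod_param[h [hL h0 hX]] /submod_param[k [kL k0 kY]] XY tXY.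
have lin0 (l : U -> V) :
    (forall a u v, l (a *: u + v) = a *: l u + l v) -> l 0 = 0.
  by move=> lL; apply/(addIr (l 0)); rewrite -{1}[l 0]scale1r -lL scale1r !add0r.
have [a v w|A AE] := @ev_ex (fun w => h w.1 + k w.2).
  by rewrite hL kL scalerDr addrACA.
have hz : h 0 = 0 by exact: lin0 hL.
have kz : k 0 = 0 by exact: lin0 kL.
exists A; split.
- apply/GL2P/inj_surj_bij.
    move=> v w vw; apply/eqP; rewrite -subr_eq0; apply/eqP.
    have : ev A (v - w) = 0.
      by rewrite addrC -scaleN1r evZD vw scaleN1r addNr.
    rewrite AE => /eqP; rewrite addr_eq0 => /eqP hk.
    have h00 : h (v - w).1 = 0.
      apply: XY; first by rewrite hX; exists (v - w).1.
      by rewrite hk; apply: submodN; rewrite kY; exists (v - w).2.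
    have k00 : k (v - w).2 = 0.
      by move: hk; rewrite h00 => /eqP; rewrite eq_sym oppr_eq0 => /eqP.
    by rewrite [LHS]surjective_pairing (h0 _ h00) (k0 _ k00).
  move=> w; have : addsub X Y w by rewrite tXY.
  case=> x [y []]; rewrite hX kY => -[u _ <-] [v _ <-] ->.
  by exists (u, v); rewrite AE.
- apply/submod_inj; rewrite hX; apply/seteqP; split=> [_ [u _ <-]|w].
    by apply/pair_image_row; exists u; rewrite AE /= kz addr0.
  by move=> /pair_image_row[u ->]; exists u; rewrite // AE /= kz addr0.
apply/submod_inj; rewrite kY; apply/seteqP; split=> [_ [u _ <-]|w].
  by apply/pair_image_row; exists u; rewrite AE /= hz add0r.
by move=> /pair_image_row[u ->]; exists u; rewrite // AE /= hz add0r.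
Qed.

End PsiTheory.

(** * The adjacency graph of the Grassmann space *)

Section Relations.
Variables (T : Type) (r : T -> T -> Prop).

Definition rel_near (x y : T) : Prop := x = y \/ r x y.

Fixpoint reach (k : nat) (x y : T) : Prop :=
  if k is k'.+1 then exists2 z, rel_near x z & reach k' z y else x = y.

Definition antipodal (x y : T) : Prop :=
  forall k, reach k x y -> forall u v, reach k u v.

Definition rel_line (x y : T) : set T :=
  [set z | forall w, rel_near w x -> rel_near w y -> rel_near w z].

Definition rel_lines : set (set T) :=
  [set l | exists x y, r x y /\ l = rel_line x y].

End Relations.

Section RelationIsomorphisms.
Variables (T T' : Type) (r : T -> T -> Prop) (r' : T' -> T' -> Prop).
Variables (f : T -> T') (g : T' -> T).
Hypotheses (fK : cancel f g) (gK : cancel g f).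
Hypothesis fr : forall x y, r x y <-> r' (f x) (f y).

Lemma rel_iso_near x y : rel_near r x y <-> rel_near r' (f x) (f y).
Proof.
by split=> [[->|/fr]|[/(can_inj fK)|/fr]]; [left | right | left | right].
Qed.

Lemma rel_iso_reach k x y : reach r k x y <-> reach r' k (f x) (f y).
Proof.
elim: k x => [|k IHk] x /=; first by split=> [->|/(can_inj fK)].
split=> -[z xz zy].
  by exists (f z); [apply/rel_iso_near | apply/IHk].
by exists (g z); [apply/rel_iso_near | apply/IHk]; rewrite gK.
Qed.

Lemma rel_iso_antipodal x y : antipodal r x y <-> antipodal r' (f x) (f y).
Proof.
split=> xy k /rel_iso_reach/xy kr u v; last exact/rel_iso_reach.
by rewrite -[u]gK -[v]gK; apply/rel_iso_reach.
Qed.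

Lemma rel_iso_line x y : f @` rel_line r x y = rel_line r' (f x) (f y).
Proof.
apply/seteqP; split=> [_ [z xyz <-] w wx wy|z xyz].
  rewrite -[w]gK; apply/rel_iso_near/xyz; apply/rel_iso_near; by rewrite gK.
exists (g z); last exact: gK.
by move=> w wx wy; apply/rel_iso_near; rewrite gK; apply: xyz; apply/rel_iso_near.
Qed.

Lemma rel_iso_lines l : rel_lines r l -> rel_lines r' (f @` l).
Proof.
by move=> [x [y [xy ->]]]; exists (f x), (f y); split; [apply/fr | apply: rel_iso_line].
Qed.

End RelationIsomorphisms.

Section Grassmann.
Variables (K : nzRingType) (hK : division_ring K).
Variables (U : vectType K) (U_gt0 : (0 < dim U)%N).
Local Notation V := (@Datatypes_prod__canonical__GRing_Lmodule K U U).
Local Notation n := (dim U).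
Implicit Types (X Y Z W C : grass U) (M N L : submod V).

Let dimV := prod_dim U_gt0.

Lemma grass_subproof X :
  (X : set V) 0 /\ forall a u v, X u -> X v -> (X : set V) (a *: u + v).
Proof. by have [Y ->] := subspace_submod (grass_setP X); apply: submodP. Qed.
Definition gsub X : submod V := Submod (grass_subproof X).

Lemma sdim_grass X : sdim X = n.
Proof. exact: (sdim_eq hK (grass_setP X)). Qed.

Lemma submod_grass M : sdim M = n -> exists X, gsub X = M.
Proof.
move=> dM; have gM : subspace_of_dim n M by rewrite -dM; exact: (sdimP hK dimV).
by exists (GrassPoint gM); apply: submod_inj.
Qed.

Lemma gsub_inj : injective gsub.
Proof. by move=> X Y XY; apply: grass_inj; rewrite -[LHS]/(gsub X : set V) XY. Qed.

Lemma grass_sub_eq X Y : X `<=` Y -> X = Y.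
Proof.
move=> XY; apply/gsub_inj/(submod_eqP hK dimV) => //.
by rewrite [leqRHS]sdim_grass [leqLHS]sdim_grass.
Qed.

Lemma grass_neq X Y : X <> Y -> exists2 x, X x & ~ (Y : set V) x.
Proof.
move=> XY; apply: contrapT => h; apply/XY/grass_sub_eq => x Xx.
by apply: contrapT => Yx; apply: h; exists x.
Qed.

Lemma sdim_grass_add X Y :
  (sdim (addsub (gsub X) (gsub Y)) + sdim (X `&` Y) = n + n)%N.
Proof.
by have := sdim_add_cap hK dimV (gsub X) (gsub Y); rewrite !sdim_grass.
Qed.

Definition opposite X Y : Prop := disjointsub (gsub X) (gsub Y).

Definition grass_near X Y : Prop := (n <= (sdim (X `&` Y)).+1)%N.

Definition grass_adjacent X Y : Prop := X <> Y /\ grass_near X Y.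

Lemma grass_nearC X Y : grass_near X Y -> grass_near Y X.
Proof. by rewrite /grass_near setIC. Qed.

Lemma grass_near_refl X : grass_near X X.
Proof. by rewrite /grass_near setIid sdim_grass. Qed.

Lemma rel_nearE X Y : rel_near grass_adjacent X Y <-> grass_near X Y.
Proof.
split=> [[->|[]//]|XY]; first exact: grass_near_refl.
by have [->|XnY] := pselect (X = Y); [left | right].
Qed.

Lemma oppositeE X Y : opposite X Y <-> sdim (X `&` Y) = 0%N.
Proof.
split=> [XY|/eqP/(sdim0P hK dimV (capsub (gsub X) (gsub Y))) XY x Xx Yx].
  by apply/eqP/(sdim0P hK dimV (capsub (gsub X) (gsub Y))) => x [] /XY; apply.
exact: XY.
Qed.

Lemma sdim_adjacent X Y : grass_adjacent X Y -> sdim (X `&` Y) = n.-1.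
Proof.
move=> [XY nXY]; have /grass_neq[x Xx Yx] := XY.
have : (sdim (addsub (capsub (gsub X) (gsub Y)) (linesub x)) <= sdim X)%N.
  apply: (sdim_leq hK dimV (Y := gsub X)); apply: addsub_lub => [y []//|].
  exact: linesub_sub.
rewrite (sdim_add_line hK dimV) ?sdim_grass => [|[]//].
by move: nXY; rewrite /grass_near /=; lia.
Qed.

Lemma opposite_through X L : disjointsub (gsub X) L ->
  exists2 C : grass U, L `<=` C & opposite C X.
Proof.
move=> /(complement hK dimV)[D [LD XD tXD]].
have [|C CD] := @submod_grass D.
  have := sdim_disjoint hK dimV XD.
  by rewrite tXD (sdim_top hK dimV) sdim_grass => /addnI.
exists C; rewrite -1?[C : set V]/(gsub C : set V) ?CD //.
by move=> x; rewrite CD => Dx Xx; apply: XD.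
Qed.

Lemma opposite_ex X : exists C, opposite C X.
Proof.
have [|C _ CX] := @opposite_through X (linesub 0); last by exists C.
by move=> x _ [k ->]; rewrite scaler0.
Qed.

Lemma opposite_subset X Y :
  (forall C, opposite C X -> opposite C Y) <-> X = Y.
Proof.
split=> [XY|-> //]; apply/esym; apply: contrapT => /grass_neq[y Yy Xy].
have [C Cy /XY/(_ y)] := opposite_through (disjoint_line hK (X := gsub X) Xy).
move=> /(_ (Cy _ (linesub_id y)) Yy) y0; apply: Xy.
by rewrite y0; apply: (submod0 (gsub X)).
Qed.

Lemma add_line_eq M N x : M `<=` N -> N x -> ~ M x -> sdim N = (sdim M).+1 ->
  addsub M (linesub x) = N.
Proof.
move=> MN Nx Mx dN; apply: (submod_eqP hK dimV).
  by apply: addsub_lub => //; apply: linesub_sub.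
by rewrite dN (sdim_add_line hK dimV).
Qed.

Lemma not_opposite X Y : ~ opposite X Y -> exists x, [/\ X x, Y x & x <> 0].
Proof.
move=> nXY; apply: contrapT => h; apply: nXY => x Xx Yx.
by apply: contrapT => x0; apply: h; exists x.
Qed.

Lemma grass_adjacentP X Y : grass_adjacent X Y <->
  exists Z, [/\ Z <> X, Z <> Y &
    forall C, opposite C Z -> opposite C X \/ opposite C Y].
Proof.
split=> [XY|[Z [ZX ZY CZ]]].
  pose M := capsub (gsub X) (gsub Y); have dM : sdim M = n.-1 := sdim_adjacent XY.
  have [/grass_neq[x Xx Yx] _] := XY.
  have [/nesym/grass_neq[y Yy Xy] _] := XY.
  have Xxy : ~ gsub X (x + y).
    by move=> /submodB/(_ Xx); rewrite addrC addKr.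
  have Yxy : ~ gsub Y (x + y).
    by move=> /submodB/(_ Yy); rewrite addrK.
  have [|Z ZE] := @submod_grass (addsub M (linesub (x + y))).
    by rewrite (sdim_add_line hK dimV) ?dM ?prednK // => -[].
  have ZS z : (Z : set V) z <-> addsub M (linesub (x + y)) z by rewrite -ZE.
  have Zxy : (Z : set V) (x + y) by apply/ZS/addsub_r/linesub_id.
  exists Z; split=> [ZX|ZY|C CZ]; try by rewrite ?ZX ?ZY in Zxy.
  have Msum (W : grass U) w z : M `<=` W -> W w -> ~ M w -> W z -> z <> 0 -> C z ->
      exists m k, [/\ M m, k != 0 & z = m + k *: w].
    move=> MW Ww Mw Wz z0 Cz.
    have : addsub M (linesub w) z.
      by rewrite (@add_line_eq M (gsub W)) ?sdim_grass ?dM ?prednK.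
    move=> [m [_ [Mm [k ->] zE]]]; exists m, k; split=> //.
    apply/eqP => k0; apply: z0; apply: CZ => //; apply/ZS/addsub_l.
    by rewrite zE k0 scale0r addr0.
  apply: contrapT => /not_orP[/not_opposite[c1 [Cc1 Xc1 c10]]].
  move=> /not_opposite[c2 [Cc2 Yc2 c20]].
  have [m1 [k1 [Mm1 k10 c1E]]] : exists m k, [/\ M m, k != 0 & c1 = m + k *: x].
    by apply: (Msum X) => //; [move=> z []|case].
  have [m2 [k2 [Mm2 k20 c2E]]] : exists m k, [/\ M m, k != 0 & c2 = m + k *: y].
    by apply: (Msum Y) => //; [move=> z []|case].
  have [[l1 l1k] [l2 l2k]] := (hK k10, hK k20).
  have scal l k m c (w : V) : l * k = 1 -> c = m + k *: w -> l *: c = l *: m + w.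
    by move=> lk ->; rewrite scalerDr scalerA lk scale1r.
  pose m := l1 *: m1 + l2 *: m2.
  have Mm : M m by apply: submodD; apply: submodZ.
  have cE : l1 *: c1 + l2 *: c2 = m + (x + y).
    by rewrite (scal l1 k1 m1 c1 x) // (scal l2 k2 m2 c2 y) // addrACA.
  have : m + (x + y) = 0.
    apply: CZ; first by rewrite -cE; apply: (submodD (X := gsub C)); apply: submodZ.
    by apply/ZS/submodD; [apply: addsub_l | apply/addsub_r/linesub_id].
  move=> /eqP; rewrite addrC addr_eq0 => /eqP xyE; apply: Xxy.
  by rewrite xyE; apply: (submodN (X := gsub X)); case: Mm.
have XY : X <> Y.
  move=> XY; apply: ZX; apply/opposite_subset => C /CZ; by rewrite -XY => -[].
split=> //.
have Yx_line x y : X x -> ~ (Z : set V) x -> Y y -> ~ (Z : set V) y ->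
    addsub (gsub Z) (linesub x) y.
  move=> Xx Zx Yy Zy; apply: contrapT => Zxy.
  have [C Cxy CZ0] := opposite_through
    (disjoint_add_line hK (disjoint_line hK (X := gsub Z) Zx) Zxy).
  have Cx : (C : set V) x by apply/Cxy/addsub_l/linesub_id.
  have Cy : (C : set V) y by apply/Cxy/addsub_r/linesub_id.
  by case: (CZ C CZ0) => [/(_ x Cx Xx)|/(_ y Cy Yy)] h; [apply: Zx|apply: Zy];
    rewrite h; apply: (submod0 (gsub Z)).
have /nesym/grass_neq[x Xx Zx] := ZX.
have /nesym/grass_neq[y Yy Zy] := ZY.
pose N := addsub (gsub Z) (linesub x).
have dN : sdim N = n.+1 by rewrite (sdim_add_line hK dimV) ?sdim_grass.
have YN : Y `<=` N.
  move=> z Yz; have [Zz|Zz] := pselect ((Z : set V) z); first exact: addsub_l.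
  exact: Yx_line.
have NE : addsub (gsub Z) (linesub y) = N.
  by apply: add_line_eq; rewrite ?sdim_grass //; [apply: addsub_l | apply: YN].
have XN : X `<=` N.
  move=> z Xz; have [Zz|Zz] := pselect ((Z : set V) z); first exact: addsub_l.
  have [z' [_ [Zz' [k ->] yE]]] := Yx_line _ _ Xz Zz Yy Zy.
  have k0 : k != 0.
    by apply/eqP => k0; apply: Zy; rewrite yE k0 scale0r addr0.
  have [l lk] := hK k0; rewrite -NE -[z]scale1r -lk -scalerA.
  apply/submodZ; exists (- z'), y; split; last by rewrite yE addKr.
    exact: (submodN (X := gsub Z)).
  exact: linesub_id.
have dXYN := sdim_leq hK dimV (addsub_lub (X := gsub X) (Y := gsub Y) XN YN).
have := sdim_grass_add X Y; rewrite dN in dXYN; rewrite /grass_near.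
lia.
Qed.

Lemma reach_grass k X Y :
  reach grass_adjacent k X Y <-> (n <= sdim (X `&` Y) + k)%N.
Proof.
elim: k X => [|k IHk] X /=.
  rewrite addn0; split=> [->|nXY]; first by rewrite setIid sdim_grass.
  have XYX : capsub (gsub X) (gsub Y) = gsub X.
    by apply: (submod_eqP hK dimV) => [x []//|]; rewrite sdim_grass.
  apply: grass_sub_eq => x; rewrite -[X x]/(gsub X x) -XYX; by case.
split=> [[Z /rel_nearE XZ /IHk ZY]|nXY].
  have := sdim_add_cap hK dimV (capsub (gsub X) (gsub Z)) (capsub (gsub Z) (gsub Y)).
  have /(sdim_leq hK dimV) : addsub (capsub (gsub X) (gsub Z))
      (capsub (gsub Z) (gsub Y)) `<=` gsub Z by apply: addsub_lub => x [].
  have /(sdim_leq hK dimV) : capsub (capsub (gsub X) (gsub Z))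
      (capsub (gsub Z) (gsub Y)) `<=` capsub (gsub X) (gsub Y).
    by move=> x [[Xx _] [_ Yx]].
  rewrite sdim_grass; move: XZ ZY; rewrite /grass_near /=.
  rewrite -[X `&` Z]/(capsub (gsub X) (gsub Z) : set V).
  rewrite -[X `&` Y]/(capsub (gsub X) (gsub Y) : set V).
  rewrite -[Z `&` Y]/(capsub (gsub Z) (gsub Y) : set V) /=; lia.
have [nXY'|nXY'] := leqP n (sdim (X `&` Y) + k).
  by exists X; [left | apply/IHk].
have dXY : (sdim (X `&` Y)).+1 = (n - k)%N by lia.
have /nesym/grass_neq[y Yy Xy] : X <> Y.
  by move=> XY; move: dXY; rewrite XY setIid sdim_grass; lia.
have [||H [XYH HX dH]] := intermediate_submod hK dimV (d := n.-1)
    (X := capsub (gsub X) (gsub Y)) (Y := gsub X).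
- by move=> x [].
- rewrite sdim_grass leq_pred andbT -[capsub _ _ : set V]/(X `&` Y); lia.
have Hy : ~ H y by move=> /HX.
have [|Z ZE] := @submod_grass (addsub H (linesub y)).
  by rewrite (sdim_add_line hK dimV) // dH prednK.
have HZ : addsub H (linesub y) `<=` Z by rewrite -ZE.
exists Z.
  apply/rel_nearE; rewrite /grass_near.
  have /(sdim_leq hK dimV) : H `<=` capsub (gsub X) (gsub Z).
    by move=> x Hx; split; [apply: HX | apply/HZ/addsub_l].
  rewrite dH /=; lia.
apply/IHk.
have /(sdim_leq hK dimV) : addsub (capsub (gsub X) (gsub Y)) (linesub y) `<=`
    capsub (gsub Z) (gsub Y).
  apply: addsub_lub => [x XYx|].
    by split; [apply/HZ/addsub_l/XYH | case: XYx].
  by apply: linesub_sub; split=> //; apply/HZ/addsub_r/linesub_id.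
rewrite (sdim_add_line hK dimV) => [|[]//] /=; lia.
Qed.

Lemma opposite_antipodal X Y :
  opposite X Y <-> antipodal grass_adjacent X Y.
Proof.
rewrite oppositeE; split=> [XY k /reach_grass|XY].
  by rewrite XY add0n => nk *; apply/reach_grass; lia.
have [C /oppositeE CX] := opposite_ex X.
have nXY : reach grass_adjacent (n - sdim (X `&` Y)) X Y.
  by apply/reach_grass; lia.
have /reach_grass := XY _ nXY C X; rewrite CX; lia.
Qed.

Lemma near_two_cases X Y W : grass_adjacent X Y -> grass_near W X ->
  grass_near W Y -> X `&` Y `<=` W \/ W `<=` addsub (gsub X) (gsub Y).
Proof.
move=> /sdim_adjacent dXY WX WY.
have [XYW|/nonsubset[w [[Ww Xw] nWYw]]] := pselect (W `&` X `<=` W `&` Y).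
  left; have WE : capsub (gsub W) (gsub X) = capsub (gsub X) (gsub Y).
    apply: (submod_eqP hK dimV) => [x WXx|].
      by split; [case: WXx | have [] := XYW x WXx].
    by rewrite [leqLHS]dXY; move: WX; rewrite /grass_near /=; lia.
  by move=> x XYx; have : capsub (gsub X) (gsub Y) x by []; rewrite -WE => -[].
right; suff WE : addsub (capsub (gsub W) (gsub Y)) (linesub w) = gsub W.
  rewrite -[W : set _]/(gsub W : set V) -WE; apply: addsub_lub => [x [_ Yx]|].
    exact: addsub_r.
  exact/linesub_sub/addsub_l.
  apply: (submod_eqP hK dimV).
  by apply: addsub_lub => [x []//|]; apply: linesub_sub.
by rewrite (sdim_add_line hK dimV) ?sdim_grass.
Qed.

Lemma subset_near M N X Y : sdim M = n.-1 -> M `<=` X -> M `<=` Y -> grass_near X Y.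
Proof.
move=> dM MX MY; have /(sdim_leq hK dimV) : M `<=` capsub (gsub X) (gsub Y).
  by move=> x Mx; split; [apply: MX | apply: MY].
by rewrite dM /grass_near /=; lia.
Qed.

Lemma supset_near N X Y : sdim N = n.+1 -> X `<=` N -> Y `<=` N -> grass_near X Y.
Proof.
move=> dN XN YN; have := sdim_grass_add X Y.
have := sdim_leq hK dimV (addsub_lub (X := gsub X) (Y := gsub Y) XN YN).
by rewrite dN /grass_near; lia.
Qed.

Definition pencil (M N : set V) : set (grass U) :=
  [set X : grass U | M `<=` X /\ X `<=` N].

Lemma sdim_add_adjacent X Y :
  grass_adjacent X Y -> sdim (addsub (gsub X) (gsub Y)) = n.+1.
Proof. by move=> /sdim_adjacent dXY; have := sdim_grass_add X Y; lia. Qed.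

Lemma grass_lineE X Y : grass_adjacent X Y ->
  rel_line grass_adjacent X Y = pencil (X `&` Y) (addsub (gsub X) (gsub Y)).
Proof.
move=> XY; have dM := sdim_adjacent XY; have dN := sdim_add_adjacent XY.
set N := addsub _ _ in dN *; pose M := capsub (gsub X) (gsub Y).
have XN : X `<=` N := @addsub_l _ _ (gsub X) (gsub Y).
have YN : Y `<=` N := @addsub_r _ _ (gsub X) (gsub Y).
have MX : M `<=` X by move=> x [].
have MY : M `<=` Y by move=> x [].
have MN : M `<=` N by move=> x /MX /XN.
apply/seteqP; split=> [Z XYZ|Z [MZ ZN] W /rel_nearE WX /rel_nearE WY]; last first.
  apply/rel_nearE; have [MW|WN] := near_two_cases XY WX WY.
    exact: (@subset_near M).
  exact: (@supset_near N).
have {XYZ}nearZ W : grass_near W X -> grass_near W Y -> grass_near W Z.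
  by move=> WX WY; apply/rel_nearE/XYZ; apply/rel_nearE.
have XnY : grass_near X Y by case: XY.
have ZX : grass_near Z X by apply/grass_nearC/nearZ => //; apply: grass_near_refl.
have ZY : grass_near Z Y.
  by apply/grass_nearC/nearZ; [apply: grass_nearC | apply: grass_near_refl].
have dV : (sdim (topsub V) = n + n)%N := sdim_top hK dimV.
suff [MZ ZN] : M `<=` Z /\ Z `<=` N by [].
have [MZ|ZN] := near_two_cases XY ZX ZY; split=> //; apply: contrapT.
  (* A point W of N missing some m in X & Y cannot be near Z: as N & Z = X & Y,
     it would contain m. *)
  move=> /nonsubset[z [Zz Nz]].
  have [m Mm m0] : exists2 m, M m & m <> 0.
    apply: contrapT => h; apply: Nz.
    have /eqP : sdim M = 0%N.
      apply/eqP/(sdim0P hK dimV M) => x Mx; apply: contrapT => x0.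
      by apply: h; exists x.
    rewrite [sdim M]dM => n1.
    have -> : N = topsub V by apply: (submod_eqP hK dimV) => //; lia.
    by [].
  have [C [_ mC tmC]] : exists C : submod V, [/\ linesub 0 `<=` C,
      disjointsub (linesub m) C & addsub (linesub m) C = topsub V].
    by apply: (complement hK dimV) => x _ [k ->]; rewrite scaler0.
  have /eqP m0' := m0.
  have dC := sdim_disjoint hK dimV mC.
  rewrite tmC dV (sdim_line hK m0') in dC.
  have dNC := sdim_add_cap hK dimV N C.
  have dNC' := sdim_leq hK dimV (X := addsub N C) (Y := topsub V) (fun _ _ => I).
  have d0 : sdim (linesub (0 : V)) = 0%N.
    by apply/eqP/(sdim0P hK dimV) => x [k ->]; rewrite scaler0.
  have [||L [_ LNC dL]] := intermediate_submod hK dimV (d := n)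
      (X := linesub 0) (Y := capsub N C).
  - by apply: linesub_sub; apply: submod0.
  - by rewrite d0; lia.
  have [W WE] := submod_grass dL.
  have WNC : W `<=` capsub N C by rewrite -[W : set V]/(gsub W : set V) WE.
  have WN : W `<=` N by move=> x /WNC[].
  have WZ : grass_near W Z by apply: nearZ; apply: (@supset_near N).
  have dNZ := sdim_leq hK dimV (X := addsub (capsub N (gsub Z)) (linesub z)) (Y := gsub Z).
  have {}dNZ : (sdim (capsub N (gsub Z)) < n)%N.
    rewrite -[ltnRHS](sdim_grass Z) -(sdim_add_line hK dimV (x := z)); last by case.
    by apply: dNZ; apply: addsub_lub => [x []//|]; apply: linesub_sub.
  have WZE : capsub (gsub W) (gsub Z) = capsub N (gsub Z).
    apply: (submod_eqP hK dimV) => [x [Wx Zx]|]; first by split; [apply: WN|].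
    by move: WZ dNZ; rewrite /grass_near /=; lia.
  have [/WNC[_ Cm] _] : capsub (gsub W) (gsub Z) m.
    by rewrite WZE; split; [apply: MN | apply: MZ].
  by apply: m0; apply: mC Cm; apply: linesub_id.
(* Dually, W = M + <v> with v outside N cannot be near Z, since M + Z = N. *)
move=> /nonsubset[m [Mm Zm]].
have [v Nv] : exists v, ~ N v.
  apply: contrapT => /forallNP h; apply: Zm.
  have NE : N = topsub V.
    by apply: submod_eq => // v _; apply: contrapT; apply: h.
  have n1 : n = 1%N by move: dN; rewrite NE dV; lia.
  have /eqP/(sdim0P hK dimV M) M0 : sdim M = 0%N by rewrite [LHS]dM n1.
  by rewrite (M0 m Mm); apply: (submod0 (gsub Z)).
have Mv : ~ M v by move=> /MN.
have [|W WE] := @submod_grass (addsub M (linesub v)).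
  by rewrite (sdim_add_line hK dimV) // [sdim M]dM prednK.
have WS : addsub M (linesub v) `<=` W by rewrite -WE.
have MW : M `<=` W by move=> x Mx; apply/WS/addsub_l.
have WZ : grass_near W Z by apply: nearZ; apply: (@subset_near M).
have NWZ : addsub N (linesub v) `<=` addsub (gsub W) (gsub Z).
  have <- : addsub (gsub Z) (linesub m) = N.
    by apply: add_line_eq; rewrite ?sdim_grass //; apply: MN.
  apply: addsub_lub; last first.
    by apply: linesub_sub; apply: addsub_l; apply/WS/addsub_r/linesub_id.
  apply: addsub_lub; first exact: addsub_r.
  by apply: linesub_sub; apply/addsub_l/MW.
have := sdim_leq hK dimV NWZ; rewrite (sdim_add_line hK dimV) // dN.
by have := sdim_grass_add W Z; move: WZ; rewrite /grass_near; lia.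
Qed.

Lemma grass_linesE : @grass_lines K U = rel_lines grass_adjacent.
Proof.
apply/seteqP; split=> [_ [M0 [N0 [dM dN MN ->]]]|_ [X [Y [XY ->]]]].
  have [M ME] := subspace_submod dM; have [N NE] := subspace_submod dN.
  move: dM dN MN; rewrite {}ME {}NE.
  move=> /(sdim_eq hK) dM /(sdim_eq hK) dN MN.
  have [|x Nx Mx] := sdim_ltP hK dimV MN; first by rewrite dM dN; lia.
  have [|X XE] := @submod_grass (addsub M (linesub x)).
    by rewrite (sdim_add_line hK dimV) // dM prednK.
  have XN : gsub X `<=` N.
    by rewrite XE; apply: addsub_lub => //; apply: linesub_sub.
  have [|y Ny Xy] := sdim_ltP hK dimV XN; first by rewrite dN sdim_grass.
  have MX : M `<=` gsub X by rewrite XE; apply: addsub_l.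
  have My : ~ M y by move=> /MX.
  have [|Y YE] := @submod_grass (addsub M (linesub y)).
    by rewrite (sdim_add_line hK dimV) // dM prednK.
  have MY : M `<=` gsub Y by rewrite YE; apply: addsub_l.
  have YN : gsub Y `<=` N.
    by rewrite YE; apply: addsub_lub => //; apply: linesub_sub.
  have Yy : gsub Y y by rewrite YE; apply/addsub_r/linesub_id.
  have XY : grass_adjacent X Y.
    split; first by move=> XY; apply: Xy; rewrite XY.
    exact: (@subset_near M).
  exists X, Y; split=> //; rewrite (grass_lineE XY).
  have -> : addsub (gsub X) (gsub Y) = N.
    apply: (submod_eqP hK dimV); first exact: addsub_lub.
    by rewrite dN sdim_add_adjacent.
  rewrite -[X `&` Y]/(capsub (gsub X) (gsub Y) : set V).
  suff <- : M = capsub (gsub X) (gsub Y) by [].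
  apply: (submod_eqP hK dimV); first by move=> z Mz; split; [apply: MX|apply: MY].
  by rewrite dM -(sdim_adjacent XY).
exists (X `&` Y), (addsub (gsub X) (gsub Y)); split; last exact: grass_lineE.
- by rewrite -(sdim_adjacent XY); apply: (sdimP hK dimV (capsub (gsub X) (gsub Y))).
- by rewrite -(sdim_add_adjacent XY); apply: (sdimP hK dimV).
- by move=> x [Xx _]; apply: addsub_l.
Qed.

Lemma grass_adjacent_line X Y : grass_adjacent X Y <->
  X <> Y /\ exists2 l, @grass_lines K U l & l X /\ l Y.
Proof.
split=> [XY|[XY [_ [M0 [N0 [dM _ _ ->]]] [[MX _] [MY _]]]]].
  split; first by case: XY.
  exists (rel_line grass_adjacent X Y); first by rewrite grass_linesE; exists X, Y.
  by split=> W.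
split=> //; have [M ME] := subspace_submod dM.
by apply: (@subset_near M); rewrite -?ME //; apply: (sdim_eq hK).
Qed.

Lemma Psi_bij : bijective (Psi U_gt0).
Proof.
apply: inj_surj_bij; first exact: Psi_inj.
move=> X; have [C CX] := opposite_ex X.
have dCX := sdim_disjoint hK dimV CX.
have tCX : addsub (gsub C) (gsub X) = topsub V.
  by apply: (submod_eqP hK dimV); rewrite // dCX !sdim_grass (sdim_top hK dimV).
have XC : disjointsub (gsub X) (gsub C) by move=> x Xx Cx; apply: CX.
rewrite addsubC in tCX.
have [A [gA XE _]] := @complement_GL2 K U U_gt0 (gsub X) (gsub C)
  (grass_setP X) (grass_setP C) XC tCX.
exists (ProjPoint (ex_intro2 _ _ A gA (erefl _))); apply: grass_inj => /=.
by rewrite (@Psi_setE _ _ _ _ (row 0 A)) // -[RHS]/(gsub X : set V) XE.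
Qed.

Lemma distantE p q : distant p q <-> opposite (Psi U_gt0 p) (Psi U_gt0 q).
Proof.
split=> [[A [gA pA qA]]|pq].
  have [d _] := GL2_pair_sub gA; move=> x /=.
  by rewrite (Psi_setE pA) (Psi_setE qA); apply: d.
have d := sdim_disjoint hK dimV pq.
have t : addsub (gsub (Psi U_gt0 p)) (gsub (Psi U_gt0 q)) = topsub V.
  by apply: (submod_eqP hK dimV); rewrite // d !sdim_grass (sdim_top hK dimV).
have [A [gA pA qA]] := @complement_GL2 K U U_gt0 (gsub (Psi U_gt0 p)) (gsub (Psi U_gt0 q))
  (grass_setP _) (grass_setP _) pq t.
have [rA0 rA1] := row_xrow2 A.
have PsiE (r : proj_line (end_ring U_gt0)) B (gB : GL2 B) :
    gsub (Psi U_gt0 r) = pair_sub (row 0 B) -> r = cyc (row 0 B) :> set _.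
  move=> rB; have -> : r = ProjPoint (ex_intro2 _ _ B gB (erefl _)); last by [].
  apply/(@Psi_inj _ _ U_gt0)/gsub_inj; rewrite rB; apply: submod_inj => /=.
  by rewrite (@Psi_setE _ _ _ _ (row 0 B)).
exists A; split=> //; first exact: PsiE.
by rewrite -rA0; apply: PsiE; [apply: GL2_xrow | rewrite rA0].
Qed.

Lemma parallelE (p q : proj_line (end_ring U_gt0)) : parallel p q <-> p = q.
Proof.
have [Psi' PsiK Psi'K] := Psi_bij.
split=> [pq|->]; last by move=> r.
apply: (can_inj PsiK); apply/opposite_subset => C.
by rewrite -[C]Psi'K -!distantE; apply: pq.
Qed.

Lemma adjacentE p q : adjacent p q <-> grass_adjacent (Psi U_gt0 p) (Psi U_gt0 q).
Proof.
have [Psi' PsiK Psi'K] := Psi_bij.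
rewrite grass_adjacentP; split=> [[r [rp rq rpq]]|[Z [Zp Zq Zpq]]].
  exists (Psi U_gt0 r); split.
  - by move=> /(can_inj PsiK)/parallelE.
  - by move=> /(can_inj PsiK)/parallelE.
  by move=> C; rewrite -[C]Psi'K -!distantE; apply: rpq.
exists (Psi' Z); split.
- by move=> /parallelE pE; apply: Zp; rewrite -pE Psi'K.
- by move=> /parallelE qE; apply: Zq; rewrite -qE Psi'K.
by move=> c; rewrite /distant_set /= distantE Psi'K => /Zpq; rewrite -!distantE.
Qed.

End Grassmann.

Lemma distant_adjacent_isomorphism (R R' : nzRingType)
    (phi : proj_line R -> proj_line R') :
  distant_isomorphism phi -> adjacent_isomorphism phi.
Proof.
move=> [phi_bij phi_d]; split=> // p q; have [psi phiK psiK] := phi_bij.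
have par s t : parallel s t <-> parallel (phi s) (phi t).
  split=> st c; last by move=> /phi_d/st/phi_d.
  by rewrite /distant_set /= -[c]psiK => /phi_d/st/phi_d.
split=> -[r [rp rq rpq]].
  exists (phi r); split; rewrite -?par // => c.
  rewrite /distant_set /= -[c]psiK => /phi_d/rpq[]/phi_d; by [left|right].
exists (psi r); split; rewrite ?par ?psiK // => c.
by rewrite /distant_set /= => /phi_d; rewrite psiK => /rpq[]/phi_d; [left|right].
Qed.

Lemma skew_field_division (K : unitRingType) : is_skew_field K -> division_ring K.
Proof. by move=> hK x /hK x_unit; exists x^-1; apply: mulVr. Qed.

Theorem proposition5p2 (K K' : unitRingType)
    (hK : is_skew_field K) (hK' : is_skew_field K')
    (U : vectType K) (U' : vectType K')
    (hU : (0 < dim U)%N) (hU' : (0 < dim U')%N)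
    (phi : proj_line (end_ring hU) -> proj_line (end_ring hU')) :
  [<-> distant_isomorphism phi;
       adjacent_isomorphism phi;
       collineation (@grass_lines K U) (@grass_lines K' U')
         (Psi hU' \o phi \o Psi_inv hU)].
Proof.
have dK := skew_field_division hK; have dK' := skew_field_division hK'.
have PsiK : cancel (Psi hU) (Psi_inv hU).
  move=> p; apply: (pinvKV (fun=> proj_base _)); rewrite ?in_setT //.
  by move=> p1 p2 _ _; apply: Psi_inj.
have [Psi0 Psi0K Psi0K'] := Psi_bij dK hU.
have PsiK' : cancel (Psi_inv hU) (Psi hU).
  by move=> X; rewrite -[X]Psi0K' PsiK.
have [Psi0' PsiK0' Psi'K0] := Psi_bij dK' hU'.
set f := _ \o _.
have fE p : f (Psi hU p) = Psi hU' (phi p) by rewrite /f /= PsiK.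
tfae; first exact: distant_adjacent_isomorphism.
- move=> [[psi phiK psiK] phi_a].
  pose g := Psi hU \o psi \o Psi0'.
  have fK : cancel f g by move=> X; rewrite /f /g /= PsiK0' phiK PsiK'.
  have gK : cancel g f by move=> X; rewrite /f /g /= PsiK psiK Psi'K0.
  have fr X Y : grass_adjacent X Y <-> grass_adjacent (f X) (f Y).
    rewrite -[X]PsiK' -[Y]PsiK' !fE; split.
      by move=> /(adjacentE dK)/phi_a/(adjacentE dK').
    by move=> /(adjacentE dK')/phi_a/(adjacentE dK).
  have gr X Y : grass_adjacent X Y <-> grass_adjacent (g X) (g Y).
    by rewrite (fr (g X)) !gK.
  exists g; split=> // l; rewrite !grass_linesE //.
    exact: rel_iso_lines fK gK fr l.
  exact: rel_iso_lines gK fK gr l.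
move=> [g [fK gK fL gL]].
have fr X Y : grass_adjacent X Y <-> grass_adjacent (f X) (f Y).
  rewrite !grass_adjacent_line //; split=> -[XY [l Ll [lX lY]]].
    split; first by move=> /(can_inj fK).
    by exists (f @` l); [apply: fL | split; [exists X | exists Y]].
  split; first by move=> XE; apply: XY; rewrite XE.
  exists (g @` l); first exact: gL.
  by split; [exists (f X) | exists (f Y)]; rewrite ?fK.
split.
  exists (Psi_inv hU \o g \o Psi hU') => p /=; first by rewrite -fE fK PsiK.
  by apply: (can_inj PsiK0'); rewrite -fE PsiK' gK.
move=> p q; rewrite (distantE dK) (distantE dK') -!fE.
rewrite (opposite_antipodal dK hU) (opposite_antipodal dK' hU').
exact: rel_iso_antipodal fK gK fr _ _.
Qed.
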